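(* For the unidirectional maintenance scheduling problem, the LP relaxation of the model [uniSCM] is at least as strong as the LP relaxation of the model [PIM]; that is, for every instance, if $z_1$ and $z_2$ are the optimal values of the LP relaxations of [uniSCM] and [PIM], respectively, then $z_1\ge z_2$.
   Context: Unidirectional maintenance scheduling problem: there are paths $\mathcal P=\{\ell_1,\dots,\ell_m\}$ and a finite set $\mathcal J$ of jobs; job $j$ is described by integers $r'_j,d'_j,p'_j$ with $1\le r'_j\le d'_j\le m$ and $1\le p'_j\le d'_j-r'_j+1$. Write $[\ell_a,\ell_b]=\{\ell_a,\dots,\ell_b\}$. The collection of possessions of job $j$ is $\mathcal R_j=\{[\ell_a,\ell_{a+p'_j-1}] : r'_j\le a\le d'_j-p'_j+1\}$, and $\mathcal R=\bigcup_{j\in\mathcal J}\mathcal R_j$. One has to select one possession per job, minimising the cardinality of their union. Path indexed model [PIM]: minimise $\sum_{\ell\in\mathcal P}y_\ell$ subject to $\sum_{R\in\mathcal R_j}x_R\ge1$ for all $j\in\mathcal J$; $y_\ell\ge x_R$ for all $R\in\mathcal R$ and $\ell\in R$; $x_R\in\{0,1\}$ for all $R\in\mathcal R$; $y_\ell\in\{0,1\}$ for all $\ell\in\mathcal P$. Unidirectional set cover model [uniSCM]: with $B_j=\{(i,k) : 1\le i\le k\le m,\ \exists R\in\mathcal R_j,\ R\subseteq[\ell_i,\ell_k]\}$, minimise $\sum_{1\le i\le k\le m}(k-i+1)x_{ik}$ subject to $\sum_{(i,k)\in B_j}x_{ik}\ge1$ for all $j\in\mathcal J$, and $x_{ik}\in\{0,1\}$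 for all $1\le i\le k\le m$. The LP relaxation of either model is obtained by replacing each condition ''$\in\{0,1\}$'' by ''$\in[0,1]$''. *)

(* Defs.v *)
From mathcomp Require Import all_boot all_order all_algebra.

Set Implicit Arguments.
Unset Strict Implicit.
Unset Printing Implicit Defensive.

Import GRing.Theory Num.Theory.
Local Open Scope ring_scope.

(* The bounds force all three integers to be positive, hence the type nat. *)
Record job (m : nat) := Job {
  release : nat;
  deadline : nat;
  proc : nat;
  window_bounds : (1 <= release <= deadline)%N && (deadline <= m)%N;
  proc_bounds : (1 <= proc <= deadline - release + 1)%N
}.

(* All indices are 1-based, as in [l_a, l_b] with 1 <= a <= b <= m; the path
   l_t is the element of 'I_m of value t - 1. *)
Definition path_itv (m a b : nat) : {set 'I_m} :=
  [set l : 'I_m | (a <= l.+1 <= b)%N].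

(* No subtraction truncates here: the bounds of job give 1 <= proc <= deadline.
   They also give a <= deadline - proc + 1 <= m, so that letting a range over
   0, ..., m loses no start index. *)
Definition possessions (m : nat) (j : job m) : {set {set 'I_m}} :=
  [set path_itv m a (a + proc j - 1)
     | a : 'I_m.+1 & (release j <= a <= deadline j - proc j + 1)%N].

Definition all_possessions (m : nat) (J : finType) (jb : J -> job m) :
    {set {set 'I_m}} :=
  \bigcup_(j : J) possessions (jb j).

(* For 1 <= i <= k <= m, this says (i, k) \in B_j, the index set of the covering
   constraint of j in the set cover model. *)
Definition covers (m : nat) (j : job m) (i k : nat) : bool :=
  [exists R in possessions j, R \subset path_itv m i k].

Definition binary (K : realFieldType) : pred K :=
  [pred t | (t == 0) || (t == 1)].

Definition unit_itv (K : realFieldType) : pred K := [pred t | 0 <= t <= 1].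

(* PIM is the path indexed model and uniSCM the unidirectional set cover model.
   The models are parametrised by the domain D of the variables: D = binary
   gives the integer program and D = unit_itv its LP relaxation. Variables are
   total functions, but only the values at the indices of the model (possessions
   R for x in PIM, pairs 1 <= i <= k <= m in uniSCM) occur. *)
Definition PIM_feasible (K : realFieldType) (D : pred K) (m : nat)
    (J : finType) (jb : J -> job m)
    (xy : ({set 'I_m} -> K) * ('I_m -> K)) : Prop :=
  let: (x, y) := xy in
  [/\ forall j : J, 1 <= \sum_(R in possessions (jb j)) x R,
      forall R : {set 'I_m}, R \in all_possessions jb ->
        forall l : 'I_m, l \in R -> x R <= y l,
      forall R : {set 'I_m}, R \in all_possessions jb -> D (x R)
    & forall l : 'I_m, D (y l)].

Definition PIM_objective (K : realFieldType) (m : nat)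
    (xy : ({set 'I_m} -> K) * ('I_m -> K)) : K :=
  \sum_(l < m) xy.2 l.

Definition uniSCM_feasible (K : realFieldType) (D : pred K) (m : nat)
    (J : finType) (jb : J -> job m) (x : nat -> nat -> K) : Prop :=
  (forall j : J,
     1 <= \sum_(1 <= i < m.+1) \sum_(i <= k < m.+1 | covers (jb j) i k) x i k)
  /\ (forall i k : nat, (1 <= i <= k)%N -> (k <= m)%N -> D (x i k)).

Definition uniSCM_objective (K : realFieldType) (m : nat)
    (x : nat -> nat -> K) : K :=
  \sum_(1 <= i < m.+1) \sum_(i <= k < m.+1) (k - i + 1)%:R * x i k.

Definition optimal_value (K : realFieldType) (V : Type)
    (feasible : V -> Prop) (objective : V -> K) (z : K) : Prop :=
  (exists2 v, feasible v & objective v = z)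
  /\ (forall v, feasible v -> z <= objective v).

Definition PIM_LP_value (K : realFieldType) (m : nat) (J : finType)
    (jb : J -> job m) (z : K) : Prop :=
  optimal_value (PIM_feasible (unit_itv (K:=K)) jb) (@PIM_objective K m) z.

Definition uniSCM_LP_value (K : realFieldType) (m : nat) (J : finType)
    (jb : J -> job m) (z : K) : Prop :=
  optimal_value (uniSCM_feasible (unit_itv (K:=K)) jb)
    (@uniSCM_objective K m) z.

(* Main.v *)
Require Import Defs.
From mathcomp Require Import all_boot all_order all_algebra.
Import Order.TTheory GRing.Theory Num.Theory.
Local Open Scope ring_scope.

(** A fractional solution [x] of the set cover relaxation is spread over the
    paths, and the result is a solution of the path indexed relaxation that
    costs no more. For a set [R] of paths let [mass_over x R] be the total
    weight of the intervals that contain [R]. Put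
    [X R = min 1 (mass_over x R)] and [y l = min 1 (mass_over x [set l])].

    - Linking: if [l \in R], every interval that contains [R] contains [l], so
      [X R <= y l].
    - Covering: every interval that covers job [j] contains at least one
      possession of [j], so the masses of the possessions of [j] sum to at least
      1 ([possession_mass_ge1]). Truncating each of these masses at 1 keeps
      the sum at least 1 ([sum_truncated_ge1]).
    - Cost: exchanging summations, the total mass of the single paths counts
      each interval with its number of paths, which is at most [k - i + 1]
      ([sum_path_mass_le]).

    Masses do not depend on jobs. This matters because a possession may be
    shared by several jobs while the path indexed model has a single variable
    for it: routing the weight of an interval to one chosen possession for each
    job would not define [x_R] consistently. *)

Definition itv_pairs (m : nat) : seq (nat * nat) :=
  [seq (i, k) | i <- index_iota 1 m.+1, k <- index_iota i m.+1].

Lemma mem_itv_pairs (m : nat) (p : nat * nat) :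
  p \in itv_pairs m -> (1 <= p.1 <= p.2)%N /\ (p.2 <= m)%N.
Proof.
case/allpairsPdep=> i [k [i_in k_in ->]] /=.
move: i_in k_in; rewrite !mem_index_iota => /andP[i_gt0 _] /andP[le_ik lt_km].
by rewrite i_gt0 le_ik.
Qed.

Lemma sum_itv_pairs (K : nmodType) (m : nat) (C : nat -> nat -> bool)
    (F : nat -> nat -> K) :
  \sum_(1 <= i < m.+1) \sum_(i <= k < m.+1 | C i k) F i k
  = \sum_(p <- itv_pairs m | C p.1 p.2) F p.1 p.2.
Proof.
rewrite [RHS]big_mkcond big_allpairs_dep /=.
by apply: eq_bigr => i _; rewrite big_mkcond.
Qed.

Lemma card_path_itv_le (m i k : nat) :
  (1 <= i <= k)%N -> (#|path_itv m i k| <= k - i + 1)%N.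
Proof.
case/andP=> i_gt0 le_ik.
rewrite cardE -(size_map val) -(size_iota i.-1 (k - i + 1)).
apply: uniq_leq_size; first by rewrite (map_inj_uniq val_inj) enum_uniq.
move=> t /mapP[l]; rewrite mem_enum inE => /andP[le_il lt_lk] ->.
(* The path of 1-based index [t] has value [t - 1], whence the shift by one. *)
by rewrite mem_iota -subn1 leq_subLR add1n le_il subn1 addn1 addnS
   -addSn prednK // subnKC.
Qed.

(** If one of the truncations is effective it already contributes 1;
    otherwise truncating changes nothing. *)
Lemma sum_truncated_ge1 (K : realDomainType) (T : finType) (A : {pred T})
    (f : T -> K) :
  (forall t, 0 <= f t) -> 1 <= \sum_(t in A) f t ->
  1 <= \sum_(t in A) Num.min 1 (f t).
Proof.
move=> f_ge0 sum_ge1.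
have min_ge0 t : 0 <= Num.min 1 (f t) by rewrite le_min ler01 f_ge0.
case: (boolP [exists t in A, 1 <= f t]) => [/existsP[t /andP[At ft_ge1]]|].
  by rewrite (bigD1 t) //= min_l // lerDl sumr_ge0.
rewrite negb_exists => /forallP no_ge1.
rewrite (eq_bigr f) // => t At; rewrite min_r // ltW //.
by move: (no_ge1 t); rewrite negb_and At /= -ltNge.
Qed.

Definition mass_over (K : realFieldType) (m : nat) (x : nat -> nat -> K)
    (R : {set 'I_m}) : K :=
  \sum_(p <- itv_pairs m | R \subset path_itv m p.1 p.2) x p.1 p.2.

Section NonnegativeWeights.

Variables (K : realFieldType) (m : nat) (x : nat -> nat -> K).
Hypothesis x_ge0 : forall p, p \in itv_pairs m -> 0 <= x p.1 p.2.

Lemma mass_over_ge0 (R : {set 'I_m}) : 0 <= mass_over K m x R.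
Proof. by rewrite /mass_over big_seq_cond sumr_ge0 // => p /andP[/x_ge0]. Qed.

Lemma mass_over_anti (R S : {set 'I_m}) :
  R \subset S -> mass_over K m x S <= mass_over K m x R.
Proof.
move=> sRS; rewrite /mass_over big_mkcond [leRHS]big_mkcond /=.
rewrite big_seq [leRHS]big_seq; apply: ler_sum => p p_in.
case: ifP => [sSp | _].
  by rewrite (subset_trans sRS sSp).
by case: ifP => // _; apply: x_ge0.
Qed.

(** An interval covering [j] is counted once for each possession of [j] that it
    contains, hence at least once. *)
Lemma possession_mass_ge1 (j : job m) :
  1 <= \sum_(p <- itv_pairs m | covers j p.1 p.2) x p.1 p.2 ->
  1 <= \sum_(R in possessions j) mass_over K m x R.
Proof.
move/le_trans; apply.
rewrite /mass_over (exchange_big_dep xpredT) //= big_mkcond /=.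
rewrite big_seq [leRHS]big_seq; apply: ler_sum => p p_in.
have xp_ge0 := x_ge0 p p_in.
case: ifP => [/existsP[R /andP[Rj sRp]] | _]; last exact: sumr_ge0.
by rewrite (bigD1 R) ?Rj //= lerDl sumr_ge0.
Qed.

(** The mass of a single path is the total weight of the intervals through it;
    double counting incidences of paths and intervals turns the sum over paths
    into the sum of the weights times the interval lengths. *)
Lemma sum_path_mass_le :
  \sum_(l < m) mass_over K m x [set l] <= uniSCM_objective m x.
Proof.
rewrite /uniSCM_objective
  (sum_itv_pairs K m (fun _ _ => true) (fun i k => (k - i + 1)%:R * x i k)).
rewrite /mass_over (exchange_big_dep xpredT) //=.
rewrite big_seq [leRHS]big_seq; apply: ler_sum => p p_in.
have [le_p _] := mem_itv_pairs m p p_in.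
rewrite (eq_bigl (mem (path_itv m p.1 p.2))); last by move=> l; rewrite sub1set.
rewrite sumr_const -[leLHS]mulr_natl ler_wpM2r ?x_ge0 // ler_nat.
exact: card_path_itv_le.
Qed.

End NonnegativeWeights.

Lemma PIM_feasible_of_uniSCM (K : realFieldType) (m : nat) (J : finType)
    (jb : J -> job m) (x : nat -> nat -> K) :
  uniSCM_feasible (unit_itv (K:=K)) jb x ->
  exists2 xy, PIM_feasible (unit_itv (K:=K)) jb xy
            & PIM_objective xy <= uniSCM_objective m x.
Proof.
case=> x_cover x_unit.
have x_ge0 p : p \in itv_pairs m -> 0 <= x p.1 p.2.
  by case/mem_itv_pairs=> le_p le_pm; case/andP: (x_unit _ _ le_p le_pm).
have mass_ge0 := mass_over_ge0 K m x x_ge0.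
have min_unit R : unit_itv (K:=K) (Num.min 1 (mass_over K m x R)).
  by rewrite /unit_itv /= le_min ler01 mass_ge0 ge_min lexx.
exists (fun R => Num.min 1 (mass_over K m x R),
        fun l => Num.min 1 (mass_over K m x [set l])).
  split=> [j | R _ l lR | R _ | l] //.
    apply: sum_truncated_ge1 => //; apply: possession_mass_ge1 => //.
    by rewrite -(sum_itv_pairs K m (covers (jb j)) x).
  rewrite le_min ge_min lexx ge_min /=.
  by rewrite mass_over_anti ?orbT // sub1set.
apply: le_trans (sum_path_mass_le K m x x_ge0).
by apply: ler_sum => l _ /=; rewrite ge_min lexx orbT.
Qed.

Theorem proposition1 (K : realFieldType) (m : nat) (J : finType)
    (jb : J -> job m) (z1 z2 : K) :
  uniSCM_LP_value jb z1 -> PIM_LP_value jb z2 -> z2 <= z1.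
Proof.
case=> -[x x_feas <-] _ [_ z2_min].
have [xy xy_feas xy_le] := PIM_feasible_of_uniSCM K m J jb x x_feas.
exact: le_trans (z2_min xy xy_feas) xy_le.
Qed.
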